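(* Let $A$ be an $m\times d$ matrix with rational entries. The following conditions are equivalent. (i) $A$ is rainbow regular. (ii) $A$ is robustly rainbow regular. (iii) There exists a vector in $\ker(A)$ all of whose entries are positive integers, and every submatrix of $A$ obtained by deleting two columns has the same rank as $A$. (iv) There exists at least one vector in $\ker(A)$ all of whose entries are positive integers, and for every pair of distinct indices $(i,j)$ with $1\le i,j\le d$ there exist vectors $x=(x_1,\dots,x_d)$ and $y=(y_1,\dots,y_d)$ in $\ker(A)$ such that $x_iy_j\neq x_jy_i$.
   Context: For a positive integer $N$, $[N]=\{1,2,\dots,N\}$. A $k$-coloring of a set $X$ is a surjective map $c:X\to\{1,\dots,k\}$; its color classes are the preimages of single colors. A $k$-coloring of $[kn]$ is equinumerous if every color class has exactly $n$ elements. Given a coloring of a set $S$ of integers, a vector is rainbow if all its entries lie in $S$ and its entries receive pairwise distinct colors. A rational matrix $A$ is rainbow partition $k$-regular if for all positive integers $n$ and every equinumerous $k$-coloring of $[kn]$ there exists a rainbow vector in $\ker(A)$. $A$ is rainbow regular if it is rainbow partition $k$-regular for all sufficiently large $k$. $A$ is robustly rainbow regular if there exists a constant $C$, depending only on $A$, such that for every $\varepsilon>0$, every positive integer $N$, and every large enough integer $k$, the following holds: for every $k$-coloring of $[N]$ in which each color class contains at most $(C-\varepsilon)\frac{N}{\sqrt k}$ elements, there is a rainbow vector in $\ker(A)$.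
   Formalization: In the definition of robustly rainbow regular, the constant C is required to be positive and the threshold for ''large enough k'' may depend on A, C and ε but not on N; otherwise the condition would hold vacuously for every matrix. *)

(* Defs.v *)
From mathcomp Require Import all_boot all_order all_algebra.
From mathcomp Require Import reals.

Set Implicit Arguments.
Unset Strict Implicit.
Unset Printing Implicit Defensive.

Import Order.TTheory GRing.Theory Num.Theory.
Local Open Scope ring_scope.

(* The set [N] = {1, ..., N} is represented by 'I_N, the ordinal a standing   *)
(* for the integer a + 1; the set of colors {1, ..., k} is represented by     *)
(* 'I_k.                                                                      *)
Definition interval_elt (N : nat) (a : 'I_N) : rat := a.+1%:R.

Definition is_coloring (N k : nat) (c : 'I_N -> 'I_k) : Prop :=
  forall j : 'I_k, exists a : 'I_N, c a = j.

Definition color_class (N k : nat) (c : 'I_N -> 'I_k) (j : 'I_k) : {set 'I_N} :=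
  [set a | c a == j].

Definition equinumerous (k n : nat) (c : 'I_(k * n) -> 'I_k) : Prop :=
  is_coloring c /\ forall j : 'I_k, #|color_class c j| = n.

Definition in_ker (m d : nat) (A : 'M[rat]_(m, d)) (x : 'cV[rat]_d) : Prop :=
  A *m x = 0.

(* The entries of x lie in [N] (witnessed by f) and their colors are pairwise *)
(* distinct.                                                                  *)
Definition rainbow (N k d : nat) (c : 'I_N -> 'I_k) (x : 'cV[rat]_d) : Prop :=
  exists f : 'I_d -> 'I_N,
    (forall i, x i 0 = interval_elt (f i)) /\ injective (fun i => c (f i)).

Definition rainbow_partition_regular (m d : nat) (A : 'M[rat]_(m, d))
    (k : nat) : Prop :=
  forall n : nat, (0 < n)%N ->
  forall c : 'I_(k * n) -> 'I_k, equinumerous c ->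
  exists x : 'cV[rat]_d, in_ker A x /\ rainbow c x.

Definition rainbow_regular (m d : nat) (A : 'M[rat]_(m, d)) : Prop :=
  exists k0 : nat, forall k : nat, (k0 <= k)%N -> rainbow_partition_regular A k.

(* The constant C is positive, and the threshold k0 depends on eps but not on *)
(* N: with C <= 0, or with k0 allowed to exceed N, no coloring would satisfy  *)
(* the hypotheses and the notion would be empty.                              *)
Definition robustly_rainbow_regular (R : realType) (m d : nat)
    (A : 'M[rat]_(m, d)) : Prop :=
  exists C : R, 0 < C /\
  forall eps : R, 0 < eps ->
  exists k0 : nat, forall k : nat, (k0 <= k)%N ->
  forall N : nat, (0 < N)%N ->
  forall c : 'I_N -> 'I_k, is_coloring c ->
  (forall j : 'I_k,
     #|color_class c j|%:R <= (C - eps) * (N%:R / Num.sqrt k%:R)) ->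
  exists x : 'cV[rat]_d, in_ker A x /\ rainbow c x.

Definition has_positive_integer_ker_vector (m d : nat) (A : 'M[rat]_(m, d)) :
    Prop :=
  exists x : 'cV[rat]_d,
    in_ker A x /\ forall i, x i 0 \is a Num.int /\ 0 < x i 0.

(* The second deleted column is indexed among the d - 1 remaining ones, so    *)
(* that (j, i) ranges over all ways of deleting two distinct columns.         *)
Definition rank_stable_under_two_deletions (m d : nat) (A : 'M[rat]_(m, d)) :
    Prop :=
  forall (j : 'I_d) (i : 'I_d.-1), \rank (col' i (col' j A)) = \rank A.

Definition pairwise_nonproportional_ker (m d : nat) (A : 'M[rat]_(m, d)) :
    Prop :=
  forall i j : 'I_d, i <> j ->
  exists x y : 'cV[rat]_d,
    [/\ in_ker A x, in_ker A y & x i 0 * y j 0 <> x j 0 * y i 0].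

(* Main.v *)
From HB Require Import structures.
Require Import Defs.
From mathcomp Require Import all_boot all_order all_algebra.
From mathcomp Require Import reals.
From mathcomp Require Import zify ring lra.

(* (iv) => (ii): a kernel vector avoiding finitely many hyperplanes, together   *)
(* with a positive one, gives integer vectors p, q in ker A all of whose 2 x 2  *)
(* minors are nonzero. Among the order of N^2 vectors s p + t q lying in [N]^d, *)
(* those with two equally colored entries are at most d^2 N max_j |class j|,    *)
(* as two entries determine (s, t); this is o(N^2) as k grows.                  *)
(* (ii) => (i): equinumerous colorings have classes of size N / k.              *)
(* (i) => (iv): if x_i / x_j = a / b were constant on the kernel, it would be   *)
(* enough to color [kn] equinumerously with u and u * b / a always of the same  *)
(* color. The chains u, u * b/a, u * (b/a)^2, ... have length O(log (kn)) and a *)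
(* positive proportion of them are singletons, so for large n a greedy packing  *)
(* of the chains into k bins of capacity n, singletons last, fills them.        *)
(* (iii) <=> (iv): deleting columns i and j preserves the rank iff both lie in  *)
(* the span of the others, i.e. ker A projects onto coordinates (i, j).         *)

Set Implicit Arguments.
Unset Strict Implicit.
Unset Printing Implicit Defensive.

Import Order.TTheory GRing.Theory Num.Theory.
Local Open Scope ring_scope.

(** Condition (iv) is the pivot: the implications (iv) => (ii) => (i) => (iv) form a cycle, and
    linear algebra ([rank_two_deletionsP]) ties (iii) to (iv). Sufficiency is a count.
    [exists_generic_pair] finds a plane of kernel vectors in which any two coordinates determine the
    vector, and [generic_pair_rainbow] shows that small color classes spoil too few lattice points
    of that plane. Necessity is a construction. For any ratio a/b and arbitrarily large k,
    [ratio_coloring] gives an equinumerous coloring in which a rainbow vector never has two entries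
    in that ratio. For the ratio of two entries of a positive kernel vector, regularity then yields
    a kernel vector not proportional to it in these coordinates. The difficulty is exact balance,
    which [packing] supplies. *)

(** * Greedy packing of weighted items into equal bins *)

Section Packing.

Variables (I : finType) (k n : nat) (w : I -> nat).
Local Open Scope nat_scope.

Definition load (g : I -> 'I_k) (s : seq I) (j : 'I_k) : nat :=
  \sum_(x <- s | g x == j) w x.

Lemma sum_load g s : \sum_j load g s j = \sum_(x <- s) w x.
Proof. by rewrite [RHS](partition_big g xpredT). Qed.

(** Pigeonhole: if every bin held more than [n - W], the load of [s] alone would reach
    [k * (n - W).+1], leaving no room for the positive weight of [x]. *)
Lemma load_step x s W g : x \notin s -> w x <= W -> W <= n ->
    \sum_(y <- x :: s) w y <= k * (n - W).+1 ->
    (forall j, load g s j <= n) ->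
  exists g', forall j, load g' (x :: s) j <= n.
Proof.
move=> xs wW Wn tot gn.
case: (posnP (w x)) => [wx0 | wx_gt0].
  by exists g => j; rewrite /load big_cons wx0 add0n if_same; exact: gn.
have [j0 j0P] : exists j0, load g s j0 <= n - W.
  case: (pickP (fun j => load g s j <= n - W)) => [j Pj|noj]; first by exists j.
  exfalso; have : k * (n - W).+1 <= \sum_j load g s j.
    rewrite -[X in X * _]card_ord -sum_nat_const.
    by apply: leq_sum => j _; rewrite ltnNge noj.
  rewrite sum_load; move: tot; rewrite big_cons; lia.
exists (fun y => if y == x then j0 else g y) => j.
have -> : load (fun y => if y == x then j0 else g y) (x :: s) j =
    (if j0 == j then w x else 0) + load g s j.
  rewrite /load big_cons eqxx.
  rewrite (_ : \sum_(y <- s | _) w y = \sum_(y <- s | g y == j) w y).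
    by case: ifP => // _; rewrite add0n.
  rewrite big_seq_cond [RHS]big_seq_cond; apply: eq_bigl => y.
  by case: (boolP (y \in s)) => //= ys; rewrite (negPf (memPn xs _ ys)).
by case: eqP => [<-|_]; [lia | rewrite add0n].
Qed.

Lemma load_extend s1 s2 W g : uniq (s2 ++ s1) ->
    (forall x, x \in s2 -> w x <= W) -> W <= n ->
    \sum_(y <- s2 ++ s1) w y <= k * (n - W).+1 ->
    (forall j, load g s1 j <= n) ->
  exists g', forall j, load g' (s2 ++ s1) j <= n.
Proof.
move=> us wW Wn tot gn; elim: s2 us wW tot => [|x s2 IH]; first by exists g.
rewrite cat_cons /= => /andP[xs us] wW tot.
have [||g' g'n] := IH us.
- by move=> y ys; apply: wW; rewrite inE ys orbT.
- by apply: leq_trans tot; rewrite big_cons leq_addl.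
by apply: (load_step (W := W) xs _ Wn tot g'n); apply: wW; rewrite inE eqxx.
Qed.

(** Heavy items go first: the unit items set aside weigh at least [k * L], so a bin with room [L]
    always exists. Unit items then fit wherever a bin is not full. Since the total is [k * n], no
    bin can end below capacity. *)
Lemma packing L : 0 < k -> 0 < L <= n -> (forall x, w x <= L) ->
    \sum_x w x = k * n -> k * L <= \sum_(x | w x == 1) w x ->
  exists g : I -> 'I_k, forall j, \sum_(x | g x == j) w x = n.
Proof.
move=> k0 /andP[L0 Ln] wL tot ones.
pose s1 := [seq x <- enum I | w x != 1]; pose s2 := [seq x <- enum I | w x == 1].
have us1 : uniq s1 by rewrite filter_uniq // enum_uniq.
have us : uniq (s2 ++ s1).
  rewrite cat_uniq us1 filter_uniq ?enum_uniq //= andbT.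
  apply/hasPn => x; rewrite !mem_filter => /andP[w1 _].
  by rewrite (negPf w1).
have ps : perm_eq (s2 ++ s1) (enum I).
  exact: permEl (perm_filterC (fun x => w x == 1) _).
have ps_index : perm_eq (s2 ++ s1) (index_enum I) by rewrite -[index_enum I]enumT.
have totE : \sum_(y <- s2 ++ s1) w y = k * n by rewrite (perm_big _ ps_index).
have s2E : \sum_(y <- s2) w y = \sum_(x | w x == 1) w x.
  by rewrite big_filter enumT.
have [g1 g1n] : exists g, forall j, load g (s1 ++ [::]) j <= n.
  apply: (load_extend (W := L) (g := fun=> Ordinal k0)) => //.
  - by rewrite cats0.
  - by rewrite cats0; move: totE; rewrite big_cat /= s2E; nia.
  - by move=> j; rewrite /load big_nil.
rewrite cats0 in g1n.
have [|||g gn] := load_extend (W := 1) us _ _ _ g1n.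
- by move=> x; rewrite mem_filter => /andP[/eqP-> _].
- exact: leq_trans Ln.
- by rewrite totE subn1 prednK // (leq_trans L0).
exists g; have gE j : load g (s2 ++ s1) j = \sum_(x | g x == j) w x.
  by rewrite /load (perm_big _ ps_index).
have /eqP : \sum_j load g (s2 ++ s1) j = \sum_(j < k) n.
  by rewrite sum_load totE sum_nat_const card_ord.
have le_n (j : 'I_k) :
    true -> load g (s2 ++ s1) j <= n ?= iff (load g (s2 ++ s1) j == n).
  by move=> _; apply: leqif_eq; exact: gn.
rewrite (leqif_sum le_n) => /forallP gn' j.
by rewrite -gE; exact/eqP/gn'.
Qed.

End Packing.

(** * Equinumerous colorings constant on multiplicative chains *)

(** Packs whole fibres of [key]: a chosen representative carries the size of its fibre as weight,
    all other elements have weight 0, and singleton fibres are the unit items. *)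
Lemma balanced_coloring (T : finType) (K : eqType) (key : T -> K) (k n L : nat) :
    (0 < k)%N -> (0 < L <= n)%N -> #|T| = (k * n)%N ->
    (forall x, #|[set y | key y == key x]| <= L)%N ->
    (k * L <= #|[set x | [forall y, (key y == key x) ==> (y == x)]]|)%N ->
  exists c : T -> 'I_k, (forall j, #|[set a | c a == j]| = n) /\
    forall x y, key x = key y -> c x = c y.
Proof.
move=> k0 Ln cT small single.
pose rep x := odflt x [pick y | key y == key x].
have key_rep x : key (rep x) = key x.
  by rewrite /rep; case: pickP => [y /eqP|].
have rep_key x y : key x = key y -> rep x = rep y.
  move=> xy; rewrite /rep xy; case: pickP => // /(_ x).
  by rewrite xy eqxx.
pose w z := #|[set y | rep y == z]|.
have wE z : w z = (\sum_(y | rep y == z) 1)%N by rewrite sum1dep_card.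
have wL z : (w z <= L)%N.
  apply: leq_trans (small z); apply: subset_leq_card; apply/subsetP => y.
  by rewrite !inE => /eqP<-; rewrite key_rep.
have tot : (\sum_z w z = k * n)%N.
  rewrite -cT -sum1_card [RHS](partition_big rep xpredT) //=.
  by apply: eq_bigr => z _; rewrite wE.
have [|g gn] := packing k0 Ln wL tot.
  apply: leq_trans single _; rewrite -sum1_card.
  rewrite [X in (_ <= X)%N](eq_bigr (fun=> 1%N)) => [|x /eqP //].
  rewrite !sum1_card; apply: subset_leq_card; apply/subsetP => x.
  rewrite inE => /forallP xP; rewrite -[_ \in _]/(w x == 1%N).
  have uniqx y : key y = key x -> y = x.
    by move=> /eqP yx; apply/eqP; move/implyP: (xP y); apply.
  suff -> : w x = #|[set x]| by rewrite cards1.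
  congr (#|pred_of_set _|); apply/setP => y; rewrite !inE; apply/eqP/eqP => [yx|->].
    by apply: uniqx; rewrite -(key_rep y) yx.
  exact: uniqx (key_rep x).
exists (g \o rep); split => [j|x y /rep_key /= -> //].
rewrite -(gn j) -sum1dep_card [LHS](partition_big rep (fun z => g z == j)) //=.
apply: eq_bigr => z /eqP gz; rewrite wE; apply: eq_bigl => y.
by case: (rep y =P z) => [->|]; rewrite ?andbF // gz eqxx.
Qed.

(* The multiplicative chains [u, u * b/a, u * (b/a)^2, ...] are the fibres of *)
(* [key]; a prime divisor of [b] locates an element within its chain.         *)
Lemma ratio_coloring_lt (a b k0 : nat) : (0 < a < b)%N -> coprime a b ->
  exists k n (c : 'I_(k * n) -> 'I_k),
    [/\ (k0 <= k)%N, (0 < n)%N, equinumerous c &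
    forall u v : 'I_(k * n), (u.+1 * b = v.+1 * a)%N -> c u = c v].
Proof.
move=> /andP[a0 ab] cab.
have b1 : (1 < b)%N by lia.
have leqXr x y r : (x <= y -> x ^ r <= y ^ r)%N.
  by move=> xy; case: r => // r; rewrite leq_exp2r.
pose p := pdiv b; have pp : prime p by exact: pdiv_prime.
have pa : ~~ (p %| a)%N.
  by rewrite -prime_coprime // coprime_sym; apply: coprime_dvdr (pdiv_dvd b) cab.
pose e := logn p b; have e0 : (0 < e)%N by rewrite logn_gt0 mem_primes pp pdiv_dvd; lia.
pose l u := (logn p u %/ e)%N.
pose q : rat := a%:R / b%:R.
have bR : b%:R != 0 :> rat by rewrite pnatr_eq0; lia.
have aR : a%:R != 0 :> rat by rewrite pnatr_eq0; lia.
have q0 : q != 0 by rewrite mulf_neq0 ?invr_eq0.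
(* [L] bounds the chain length, linear in the exponent [M]. The margin 7 makes [L <= b ^ (t - 2)],
   hence [k * L <= b ^ (M - 2)], the number of singleton chains exhibited below. *)
pose s := k0; pose t := (s + 7)%N; pose M := (s + t)%N.
pose k := (b ^ s)%N; pose n := (b ^ t)%N; pose L := (b * M).+1.
have NE : (k * n)%N = (b ^ M)%N by rewrite -expnD.
pose key (u : 'I_(k * n)) : rat := u.+1%:R * q ^+ l u.+1.
have keyE (u v : 'I_(k * n)) r : (l u.+1 = l v.+1 + r)%N ->
    (key u == key v) = (u.+1 * a ^ r == v.+1 * b ^ r)%N.
  move=> lE; rewrite /key lE addnC exprD mulrA (inj_eq (mulIf _)) ?expf_neq0 //.
  rewrite /q expr_div_n mulrA.
  rewrite (can2_eq (divfK _) (mulfK _)) ?expf_neq0 //.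
  by rewrite -!natrX -!natrM eqr_nat.
have k_gt0 : (0 < k)%N by rewrite expn_gt0; lia.
have n_gt0 : (0 < n)%N by rewrite expn_gt0; lia.
have Lb : (L <= b ^ (t - 2))%N.
  have -> : (t - 2 = (s + 4).+1)%N by rewrite /t; lia.
  have h : (s + 7 < 2 ^ (s + 3))%N by elim: (s) => // x; rewrite !addSn expnS; lia.
  have h3 : (2 ^ (s + 3) <= b ^ (s + 3))%N by exact: leqXr.
  have h4 : (M.+1 <= b ^ (s + 4))%N.
    rewrite addnS expnS; apply: leq_trans (leq_mul b1 h3).
    by apply: leq_trans (_ : 2 * (s + 8) <= _)%N; rewrite /M /t; lia.
  rewrite expnS; rewrite /L; nia.
have Ln : (0 < L <= n)%N by rewrite (leq_trans Lb) // leq_pexp2l; lia.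
(* Within a fibre the level [l] determines the element, and [2 ^ l u <= u <= b ^ M <= 2 ^ (b * M)]
   bounds the levels. *)
have small (x : 'I_(k * n)) : (#|[set y | key y == key x]| <= L)%N.
  have lL (y : 'I_(k * n)) : (l y.+1 < L)%N.
    rewrite ltnS; apply: leq_trans (leq_div _ _) _.
    have : (2 ^ logn p y.+1 <= 2 ^ (b * M))%N.
      apply: (@leq_trans (p ^ logn p y.+1)).
        by apply: leqXr; exact: prime_gt1.
      apply: (@leq_trans y.+1); first by rewrite dvdn_leq ?pfactor_dvdnn.
      apply: (@leq_trans (b ^ M)); first by rewrite -NE.
      by rewrite expnM leqXr // ltnW // ltn_expl.
    by rewrite leq_exp2l.
  rewrite -[L]card_ord -(card_in_imset (f := fun y => Ordinal (lL y))).
    exact: max_card.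
  move=> y z; rewrite !inE => /eqP yx /eqP zx /(congr1 val) /= lyz.
  have := keyE y z 0%N; rewrite addn0 yx zx eqxx !expn0 !muln1 => /(_ lyz).
  by move=> /esym/eqP[] /val_inj.
have single : (k * L <= #|[set x | [forall y, (key y == key x) ==> (y == x)]]|)%N.
  apply: (@leq_trans (b ^ (M - 2))).
    have -> : (M - 2 = s + (t - 2))%N by rewrite /M /t; lia.
    by rewrite expnD leq_mul2l Lb orbT.
  have ME : (b ^ M = b * (b * b ^ (M - 2)))%N.
    by rewrite -!expnS; congr (_ ^ _)%N; rewrite /M /t; lia.
  (* [b ^ M - (b * r + 1)] is prime to [b] and beyond [b ^ M * (a / b)] *)
  have elt_lt (r : 'I_(b ^ (M - 2))) : (b ^ M - (b * r + 2) < k * n)%N.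
    by rewrite NE; have := ltn_ord r; nia.
  pose h r := Ordinal (elt_lt r).
  have hE r : ((h r).+1 + (b * r + 1) = b ^ M)%N.
    by rewrite /=; have := ltn_ord r; nia.
  rewrite -[X in (X <= _)%N]card_ord -(card_imset _ (f := h)); last first.
    move=> r1 r2 /(congr1 val) e12; apply: val_inj.
    by have := hE r1; have := hE r2; rewrite /= in e12 *; nia.
  apply: subset_leq_card; apply/subsetP => _ /imsetP[r _ ->]; rewrite inE.
  apply/forallP => y; apply/implyP => kyx.
  have hb : ~~ (b %| (h r).+1)%N.
    apply/negP => bh; have : (b %| (h r).+1 + (b * r + 1))%N by rewrite hE ME dvdn_mulr.
    rewrite dvdn_addr // dvdn_addr ?dvdn_mulr // dvdn1; lia.
  have ha : (b ^ M * a < (h r).+1 * b)%N.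
    by have := hE r; have := ltn_ord r; nia.
  (* A companion of lower level would force [b] to divide [h r]; one of higher level would exceed
     [b ^ M]; one of equal level is [h r] itself. *)
  case: (ltngtP (l y.+1) (l (h r).+1)) => lE.
  - have := keyE (h r) y (l (h r).+1 - l y.+1)%N; rewrite subnKC ?(ltnW lE) //.
    rewrite eq_sym kyx => /(_ erefl) /esym /eqP E; case/negP: hb.
    rewrite -(@Gauss_dvdl _ _ (a ^ (l (h r).+1 - l y.+1))) ?coprimeXr 1?coprime_sym //.
    by rewrite E dvdn_mull // dvdn_exp // subn_gt0.
  - have := keyE y (h r) (l y.+1 - l (h r).+1)%N; rewrite subnKC ?(ltnW lE) //.
    have : (0 < l y.+1 - l (h r).+1)%N by rewrite subn_gt0.
    case: (_ - _)%N => // e' _; rewrite kyx => /(_ erefl) /esym /eqP E.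
    suff : ((h r).+1 * b <= b ^ M * a)%N by rewrite leqNgt ha.
    apply: (@leq_trans (y.+1 * a)); last by rewrite leq_mul2r -NE ltn_ord orbT.
    rewrite -(@leq_pmul2r (b ^ e')) ?expn_gt0; last by lia.
    rewrite -mulnA -expnS -E expnS mulnA leq_mul2l.
    by rewrite leqXr ?orbT // ltnW.
  - have := keyE y (h r) 0%N; rewrite addn0 kyx !expn0 !muln1 => /(_ lE) /esym.
    by rewrite eqSS => /eqP yh; apply/eqP/val_inj.
have [c [cn ckey]] := balanced_coloring k_gt0 Ln (card_ord _) small single.
exists k, n, c; split => //.
- by apply: ltnW; exact: ltn_expl.
- split=> // j; have /card_gt0P[x] : (0 < #|color_class c j|)%N by rewrite cn.
  by rewrite inE => /eqP cx; exists x.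
(* As [p] does not divide [a], multiplying by b/a raises the [p]-adic valuation by [e], so the level
   by exactly one, and the key is unchanged. *)
move=> u v uv; apply: ckey; apply/esym/eqP.
rewrite (keyE v u 1%N) ?expn1 ?uv // /l.
have := congr1 (logn p) uv; rewrite !lognM //; try lia.
rewrite (_ : logn p a = 0%N); last by rewrite lognE (negPf pa) !andbF.
by rewrite addn0 => <-; rewrite divnDr ?dvdnn // divnn e0.
Qed.

(** * Kernel vectors in general position *)

(** A subspace over an infinite field is not a finite union of proper subspaces: on the line
    [x + t *: y], a functional not vanishing at both [x] and [y] has no zero for large t. *)
Lemma avoid_zeros (V : lmodType rat) (K : V -> Prop) (J : eqType)
    (phi : J -> {scalar V}) (s : seq J) :
    K 0 -> (forall (a : rat) x y, K x -> K y -> K (x + a *: y)) ->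
    (forall j, j \in s -> exists2 x, K x & phi j x != 0) ->
  exists2 x, K x & forall j, j \in s -> phi j x != 0.
Proof.
move=> K0 Kcomb; elim: s => [|i s IH] nz; first by exists 0.
have [|x Kx xs] := IH; first by move=> j js; apply: nz; rewrite inE js orbT.
have [|y Ky yi] := nz i; first by rewrite inE eqxx.
have nz_xy j : j \in i :: s -> (phi j x != 0) || (phi j y != 0).
  by rewrite inE => /predU1P[->|/xs ->]; rewrite ?yi ?orbT.
have [B BP] : exists B : nat, forall t : nat, (B <= t)%N ->
    forall j, j \in i :: s -> phi j (x + t%:R *: y) != 0.
  elim: (i :: s) nz_xy => [|j r IHr] nz_xy; first by exists 0%N.
  have [|B BP] := IHr; first by move=> l lr; apply: nz_xy; rewrite inE lr orbT.
  exists (maxn B (Num.bound (`|phi j x| / `|phi j y|))) => t.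
  rewrite geq_max => /andP[Bt tb] l; rewrite inE => /predU1P[->|]; last exact: BP.
  rewrite linearD linearZ /=; have := nz_xy j; rewrite inE eqxx => /(_ isT).
  have [->|yj _] := eqVneq (phi j y) 0; first by rewrite mulr0 addr0 orbF.
  rewrite addr_eq0; apply/eqP => E.
  have : `|phi j x| / `|phi j y| < t%:R.
    by apply: lt_le_trans (archi_boundP _) _; rewrite ?divr_ge0 // ler_nat.
  by rewrite ltr_pdivrMr ?normr_gt0 // E normrN normrM normr_nat ltxx.
by exists (x + B%:R *: y); [exact: Kcomb | exact: BP].
Qed.

Definition generic_pair m d (A : 'M[rat]_(m, d)) (p q : 'I_d -> nat) : Prop :=
  [/\ forall i, (0 < p i)%N,
      forall s t : nat, in_ker A (\col_i (s * p i + t * q i)%N%:R)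
    & forall i j, i != j -> (p i * q j != p j * q i)%N].

Lemma exists_generic_pair m d (A : 'M[rat]_(m, d)) :
  has_positive_integer_ker_vector A -> pairwise_nonproportional_ker A ->
  exists p q, generic_pair A p q.
Proof.
move=> [x [Ax xP]] AP.
have [p pE] : exists p : 'I_d -> nat, forall i, x i 0 = (p i)%:R.
  exists (fun i => Num.trunc (x i 0)) => i; have [xi x0] := xP i.
  by rewrite truncnK // natrEint xi ltW.
have p_gt0 i : (0 < p i)%N by rewrite -(ltr_nat rat) -pE; case: (xP i).
(* The 2 x 2 minors against the positive vector [p]. If one vanished at both [u] and [v], their
   coordinates at that pair would be proportional to those of [p], hence to each other. *)
pose phi (ij : 'I_d * 'I_d) (z : 'cV[rat]_d) : rat :=
  (p ij.1)%:R * z ij.2 0 - (p ij.2)%:R * z ij.1 0.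
have phi_lin ij : scalar (phi ij) by move=> a u v; rewrite /phi !mxE; ring.
pose phiL ij : {scalar 'cV[rat]_d} :=
  HB.pack (phi ij) (GRing.isLinear.Build _ _ _ _ _ (phi_lin ij)).
pose pairs := [seq ij <- enum {: 'I_d * 'I_d} | ij.1 != ij.2].
have [||ij|z Az zP] := @avoid_zeros _ (in_ker A) _ phiL pairs.
- by rewrite /in_ker mulmx0.
- by move=> a u v; rewrite /in_ker mulmxDr -scalemxAr => -> ->; rewrite scaler0 addr0.
- rewrite mem_filter => /andP[/eqP ne _]; have [u [v [Au Av uv]]] := AP _ _ ne.
  have pi : (p ij.1)%:R != 0 :> rat by rewrite pnatr_eq0 -lt0n.
  have pj : (p ij.2)%:R != 0 :> rat by rewrite pnatr_eq0 -lt0n.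
  have [u0|] := eqVneq (phi ij u) 0; last by exists u.
  have [v0|] := eqVneq (phi ij v) 0; last by exists v.
  case: uv; apply: (mulfI pi); apply: (mulfI pj).
  move: u0 v0; rewrite /phi => /eqP; rewrite subr_eq0 => /eqP u0 /eqP.
  rewrite subr_eq0 => /eqP v0.
  transitivity ((p ij.2)%:R * u ij.1 0 * ((p ij.1)%:R * v ij.2 0)); first by ring.
  by rewrite -u0 v0; ring.
(* [D] clears denominators and adding [M] times [p] removes negative entries; the minors against [p]
   only get multiplied by [D]. *)
pose D : rat := \prod_i (denq (z i 0))%:~R.
have D0 : D != 0 by apply/prodf_neq0 => i _; rewrite intr_eq0 denq_eq0.
have Dz i : D * z i 0 \is a Num.int.
  suff -> : D * z i 0 = (numq (z i 0) * \prod_(j | j != i) denq (z j 0))%:~R.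
    exact: intr_int.
  rewrite /D (bigD1 i) //= mulrAC intrM rmorph_prod /=; congr (_ * _).
  by rewrite mulrC -{1}[z i 0]divq_num_den divfK ?intr_eq0 ?denq_eq0.
pose M := Num.bound (\sum_i `|D * z i 0|).
pose y i := D * z i 0 + M%:R * (p i)%:R.
have y0 i : 0 <= y i.
  have : `|D * z i 0| <= M%:R * (p i)%:R.
    apply: (@le_trans _ _ M%:R); last by rewrite -natrM ler_nat leq_pmulr.
    apply: le_trans (ltW (archi_boundP _)); last by apply: sumr_ge0.
    by rewrite (bigD1 i) //= lerDl sumr_ge0.
  by rewrite ler_norml /y => /andP[]; lra.
pose q i := Num.trunc (y i).
have qE i : (q i)%:R = y i.
  by rewrite truncnK // natrEint y0 andbT /y rpredD ?Dz // -natrM natr_int.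
exists p, q; split => // [s t|i j ij].
  rewrite (_ : \col_i _ = (s%:R + t%:R * M%:R) *: x + (t%:R * D) *: z).
    by rewrite /in_ker mulmxDr -!scalemxAr Ax Az !scaler0 addr0.
  by apply/colP => i; rewrite !mxE pE natrD !natrM qE /y; ring.
have := zP (i, j); rewrite mem_filter mem_enum ij => /(_ isT); apply: contraNneq.
move=> /(congr1 (fun n => n%:R : rat)); rewrite !natrM !qE /y => E.
apply/eqP; apply: (mulfI D0); rewrite mulr0 /= /phi /=.
rewrite -[RHS](subrr ((p i)%:R * (D * z j 0 + M%:R * (p j)%:R))) {2}E; ring.
Qed.

(** * Counting non-rainbow vectors *)

Lemma same_color_pairs N k (c : 'I_N -> 'I_k) M :
    (forall j, #|color_class c j| <= M)%N ->
  (#|[set ab : 'I_N * 'I_N | c ab.1 == c ab.2]| <= N * M)%N.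
Proof.
move=> cM; rewrite -sum1dep_card.
rewrite -(pair_big_dep xpredT (fun a b => c a == c b) (fun _ _ => 1%N)) /=.
rewrite -[X in (_ <= X * _)%N]card_ord -sum_nat_const; apply: leq_sum => a _.
rewrite sum1dep_card; apply: leq_trans (cM (c a)); apply: subset_leq_card.
by apply/subsetP => b; rewrite !inE eq_sym.
Qed.

Lemma cramer_nat (a b a' b' s t s' t' : nat) : (a * b' != a' * b ->
  s * a + t * b = s' * a + t' * b -> s * a' + t * b' = s' * a' + t' * b' ->
  s = s' /\ t = t')%N.
Proof.
move=> /eqP det e1 e2.
have : (s%:Z - s'%:Z) * (a%:Z * b'%:Z - a'%:Z * b%:Z) = 0 by nia.
have : (t%:Z - t'%:Z) * (a%:Z * b'%:Z - a'%:Z * b%:Z) = 0 by nia.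
move=> /eqP + /eqP; rewrite !mulf_eq0; lia.
Qed.

Lemma generic_pair_rainbow m d (A : 'M[rat]_(m, d)) p q B :
    generic_pair A p q -> (0 < B)%N ->
    (forall i, p i <= B)%N -> (forall i, q i <= B)%N ->
  forall N k (c : 'I_N -> 'I_k), (2 * B <= N)%N ->
    (forall j, 16 * B ^ 2 * d ^ 2 * #|color_class c j| <= N)%N ->
  exists x : 'cV[rat]_d, in_ker A x /\ rainbow c x.
Proof.
move=> [p0 ker_pq pq_ne] B0 pB qB N k c BN cN.
(* With s, t in [[T]] the entries of s p + t q are at most [2 * B * T <= N]. Since [T >= 1], also
   [N < 4 * B * T], whose square is the source of the constant 16. *)
pose T := (N %/ (2 * B))%N.
have T0 : (0 < T)%N by rewrite divn_gt0 //; lia.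
have TN : (T * (2 * B) <= N)%N by exact: leq_trunc_div.
have NT : (N < T.+1 * (2 * B))%N by rewrite ltn_ceil; lia.
pose val_st i (st : 'I_T * 'I_T) := (st.1.+1 * p i + st.2.+1 * q i)%N.
have val_gt0 i st : (0 < val_st i st)%N by rewrite /val_st; have := p0 i; nia.
have val_lt i st : ((val_st i st).-1 < N)%N.
  have sT := ltn_ord st.1; have tT := ltn_ord st.2.
  have h1 : (st.1.+1 * p i <= T * B)%N by rewrite leq_mul.
  have h2 : (st.2.+1 * q i <= T * B)%N by rewrite leq_mul.
  by rewrite prednK //; apply: leq_trans TN; rewrite /val_st; nia.
pose f st i := Ordinal (val_lt i st).
pose bad (ij : 'I_d * 'I_d) :=
  [set st | (ij.1 != ij.2) && (c (f st ij.1) == c (f st ij.2))].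
have [st stP] : exists st, forall ij, st \notin bad ij.
  pose M := (\max_j #|color_class c j|)%N.
  have cM j : (#|color_class c j| <= M)%N.
    exact: (leq_bigmax (F := fun j => #|color_class c j|)).
  have MN : (16 * B ^ 2 * d ^ 2 * M <= N)%N.
    rewrite /M; elim/big_ind: _ => [|a b Ha Hb|j _]; rewrite ?muln0 //.
    by case: (leqP a b).
  have badM ij : (#|bad ij| <= N * M)%N.
    have [ij0|ne] := eqVneq ij.1 ij.2.
      rewrite (_ : bad ij = set0) ?cards0 //.
      by apply/setP => st; rewrite !inE ij0 eqxx.
    apply: leq_trans (same_color_pairs cM).
    (* By the nonzero minor, the two entries determine (s, t), so bad parameters inject into equally
       colored pairs. *)
    rewrite -(card_imset _ (f := fun st => (f st ij.1, f st ij.2))).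
      apply: subset_leq_card; apply/subsetP => _ /imsetP[st + ->].
      by rewrite !inE => /andP[].
    move=> [s t] [s' t'] [/(congr1 succn) e1 /(congr1 succn) e2].
    rewrite !prednK // in e1 e2.
    have [[/val_inj -> ] [/val_inj -> //]] := cramer_nat (pq_ne _ _ ne) e1 e2.
  have bad_card : (#|\bigcup_ij bad ij| < #|{: 'I_T * 'I_T}|)%N.
    apply: (@leq_ltn_trans (\sum_ij #|bad ij|)).
      apply: (big_rec2 (fun x y => (#|pred_of_set x| <= y)%N)) => [|ij y x _ H].
        by rewrite cards0.
      by rewrite (leq_trans (leq_card_setU _ _)) // leq_add2l.
    apply: (@leq_ltn_trans (\sum_(ij : 'I_d * 'I_d) N * M)); first exact: leq_sum.
    rewrite sum_nat_const !card_prod !card_ord.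
    have N4 : (N < 4 * B * T)%N by nia.
    rewrite -(@ltn_pmul2l (16 * B ^ 2)) ?muln_gt0 ?expn_gt0 ?B0 //.
    apply: (@leq_ltn_trans (N * N)).
      rewrite (_ : _ * _ = N * (16 * B ^ 2 * d ^ 2 * M))%N ?leq_mul2l ?MN ?orbT //.
      by ring.
    rewrite (_ : 16 * B ^ 2 * _ = (4 * B * T) * (4 * B * T))%N ?ltn_mul //; ring.
  have : ~~ ([set: 'I_T * 'I_T] \subset \bigcup_ij bad ij).
    by apply: contraTN bad_card => /subset_leq_card; rewrite cardsT -leqNgt.
  case/subsetPn => st _ stP; exists st => ij.
  by apply: contra stP => H; apply/bigcupP; exists ij.
exists (\col_i (st.1.+1 * p i + st.2.+1 * q i)%N%:R); split; first exact: ker_pq.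
exists (f st); split=> [i|i j cij]; first by rewrite mxE /interval_elt /= prednK.
apply/eqP; have := stP (i, j); rewrite inE /= cij eqxx andbT negbK; exact.
Qed.

(** * Deleting two columns and projections of the kernel *)

Section TwoDeletions.

Variables (m d : nat) (A : 'M[rat]_(m, d)) (j : 'I_d) (i : 'I_d.-1).

(** Selects the surviving columns, so that preserving the rank means that all columns of [A] lie in
    the span of the survivors. *)
Let S : 'M[rat]_(d.-1.-1, d) := row' i (row' j 1%:M).

Let colE : col' i (col' j A) = (S *m A^T)^T.
Proof.
rewrite trmx_mul trmxK; apply/matrixP => r l.
rewrite !mxE (bigD1 (lift j (lift i l))) //= !mxE eqxx mulr1 big1 ?addr0 // => x.
by rewrite !mxE eq_sym => /negPf ->; rewrite mulr0.
Qed.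

Let row_two_deletions l : row (lift j (lift i l)) A^T = row l (S *m A^T).
Proof.
rewrite row_mul [LHS]rowE; congr (_ *m _).
by apply/rowP => z; rewrite !mxE eqxx eq_sym.
Qed.

Let rank_stableE : (\rank (col' i (col' j A)) == \rank A) = (A^T <= S *m A^T)%MS.
Proof.
rewrite colE mxrank_tr -(mxrank_tr A).
by rewrite (mxrank_leqif_sup (submxMl S A^T)).
Qed.

(** Writing column [a] as a combination of the survivors is a linear relation among columns, that
    is, a kernel vector; [row_of_ker] reads it backwards. *)
Let ker_of_row (a b : 'I_d) : (forall l, S l a = 0) -> (forall l, S l b = 0) ->
    a != b -> (A^T <= S *m A^T)%MS ->
  exists x : 'cV[rat]_d, [/\ in_ker A x, x a 0 = 1 & x b 0 = 0].
Proof.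
move=> Sa Sb ab AS; have /submxP[D DE] := submx_trans (row_sub a _) AS.
exists (delta_mx a 0 - (D *m S)^T); split.
- rewrite /in_ker -[A]trmxK -trmx_delta -linearB /= -trmx_mul mulmxBl -rowE DE.
  by rewrite mulmxA subrr trmx0.
- by rewrite !mxE !eqxx big1 ?subr0 // => l _; rewrite Sa mulr0.
- by rewrite !mxE eq_sym (negPf ab) big1 ?subr0 // => l _; rewrite Sb mulr0.
Qed.

Let row_of_ker (x : 'cV[rat]_d) (a b : 'I_d) :
    (forall r, r != a -> r != b -> exists l, r = lift j (lift i l)) ->
  in_ker A x -> x a 0 = 1 -> x b 0 = 0 -> (row a A^T <= S *m A^T)%MS.
Proof.
move=> others Ax xa xb.
have -> : row a A^T = (delta_mx 0 a - x^T) *m A^T.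
  by rewrite mulmxBl -rowE -[x^T *m _]trmx_mul Ax trmx0 subr0.
rewrite mulmx_sum_row; apply: summx_sub => r _.
have [->|ra] := eqVneq r a; first by rewrite !mxE !eqxx xa subrr scale0r sub0mx.
have [->|rb] := eqVneq r b.
  have [->|ba] := eqVneq b a; first by rewrite !mxE !eqxx xa subrr scale0r sub0mx.
  by rewrite !mxE (negPf ba) andbF xb subrr scale0r sub0mx.
have [l ->] := others r ra rb.
by rewrite row_two_deletions scalemx_sub // row_sub.
Qed.

Lemma rank_two_deletionsP :
  \rank (col' i (col' j A)) = \rank A <->
  exists x y : 'cV[rat]_d,
    [/\ in_ker A x, in_ker A y
      & x j 0 * y (lift j i) 0 <> x (lift j i) 0 * y j 0].
Proof.
have jl : j != lift j i by exact: neq_lift.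
have Sj l : S l j = 0 by rewrite !mxE eq_sym (negPf (neq_lift _ _)).
have Sl l : S l (lift j i) = 0.
  by rewrite !mxE (inj_eq lift_inj) eq_sym (negPf (neq_lift _ _)).
split=> [/eqP | [x [y [Ax Ay /eqP]]]].
  rewrite rank_stableE => AS.
  have [x [Ax xj xl]] := ker_of_row Sj Sl jl AS.
  have [|y [Ay yl yj]] := ker_of_row Sl Sj _ AS; first by rewrite eq_sym.
  by exists x, y; split; rewrite // xj yl xl yj; apply/eqP; rewrite mulr1 mulr0 oner_eq0.
set D := x j 0 * _; rewrite -subr_eq0; set E := D - _ => E0.
have others r : r != j -> r != lift j i -> exists l, r = lift j (lift i l).
  rewrite eq_sym => /unlift_some[r' -> _].
  by rewrite (inj_eq lift_inj) eq_sym => /unlift_some[l -> _]; exists l.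
have ker_comb al be : in_ker A (al *: x + be *: y).
  by rewrite /in_ker mulmxDr -!scalemxAr Ax Ay !scaler0 addr0.
apply/eqP; rewrite rank_stableE; apply/row_subP => r.
(* Cramer's rule with determinant [E]: combinations of [x] and [y] with coordinates (1, 0), then (0,
   1), at the deleted pair. *)
have rowj : (row j A^T <= S *m A^T)%MS.
  apply: (@row_of_ker ((y (lift j i) 0 / E) *: x + (- x (lift j i) 0 / E) *: y)
            j (lift j i)) => //.
    by rewrite !mxE; apply: (mulIf E0); rewrite /E /D; field; exact: E0.
  by rewrite !mxE; field.
have rowl : (row (lift j i) A^T <= S *m A^T)%MS.
  apply: (@row_of_ker ((- y j 0 / E) *: x + (x j 0 / E) *: y) (lift j i) j) => //.
  - by move=> z zl zj; exact: others.
  - by rewrite !mxE /E /D; field; exact: E0.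
  by rewrite !mxE; field.
have [->|rj] := eqVneq r j; first by [].
have [->|rl] := eqVneq r (lift j i); first by [].
have [l ->] := others r rj rl.
by rewrite row_two_deletions row_sub.
Qed.

End TwoDeletions.

(** * The implications between the four conditions *)

Lemma rank_stable_pairwise_nonproportional m d (A : 'M[rat]_(m, d)) :
  rank_stable_under_two_deletions A <-> pairwise_nonproportional_ker A.
Proof.
split=> [AS a b /eqP ab | AP j i].
  have [b' -> _] := unlift_some ab.
  exact: (iffLR (rank_two_deletionsP A a b') (AS a b')).
by apply/rank_two_deletionsP/AP/eqP; exact: neq_lift.
Qed.

Lemma ratio_coloring (a b k0 : nat) : (0 < a)%N -> (0 < b)%N ->
  exists k n (c : 'I_(k * n) -> 'I_k),
    [/\ (k0 <= k)%N, (0 < n)%N, equinumerous c &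
    forall u v : 'I_(k * n), (u.+1 * b = v.+1 * a)%N -> c u = c v].
Proof.
wlog ab : a b / (a <= b)%N => [wl a0 b0 | a0 b0].
  case: (leqP a b) => [|/ltnW] ab; first exact: wl.
  have [k [n [c [k0k n0 ceq cP]]]] := wl b a ab b0 a0.
  by exists k, n, c; split=> // u v uv; apply/esym/cP.
have g0 : (0 < gcdn a b)%N by rewrite gcdn_gt0 a0.
have [eq_ab | ne_ab] := eqVneq a b.
  (* Ratio 1 relates an integer only to itself, so giving each integer its own color works, with
     [n = 1]. *)
  have castk : (k0 * 1 = k0)%N by rewrite muln1.
  exists k0, 1%N, (cast_ord castk); split => // [|u v]; last first.
    by rewrite eq_ab => /eqP; rewrite eqn_pmul2r // eqSS => /eqP/val_inj ->.
  split=> [j|j]; first by exists (cast_ord (esym castk) j); rewrite cast_ordKV.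
  apply/eqP/cards1P; exists (cast_ord (esym castk) j); apply/setP => u.
  by rewrite !inE; apply/eqP/eqP => [<-|->]; rewrite ?cast_ordK ?cast_ordKV.
have [||k [n [c [k0k n0 ceq cP]]]] :=
    @ratio_coloring_lt (a %/ gcdn a b) (b %/ gcdn a b) k0.
- rewrite divn_gt0 // dvdn_leq ?dvdn_gcdl //= ltn_divRL ?dvdn_gcdr //.
  by rewrite divnK ?dvdn_gcdl // ltn_neqAle ne_ab.
- by rewrite /coprime -(eqn_pmul2r g0) muln_gcdl !divnK ?dvdn_gcdl ?dvdn_gcdr // mul1n.
exists k, n, c; split=> // u v uv; apply: cP; apply/eqP.
by rewrite -(eqn_pmul2r g0) -!mulnA !divnK ?dvdn_gcdl ?dvdn_gcdr // uv.
Qed.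

Lemma rainbow_regular_necessary m d (A : 'M[rat]_(m, d)) : rainbow_regular A ->
  has_positive_integer_ker_vector A /\ pairwise_nonproportional_ker A.
Proof.
move=> [k0 regA].
have has_rainbow a b : (0 < a)%N -> (0 < b)%N ->
    exists2 f : 'I_d -> nat, in_ker A (\col_i (f i).+1%:R) &
    forall i j, i != j -> ((f i).+1 * b != (f j).+1 * a)%N.
  move=> a0 b0; have [k [n [c [k0k n0 ceq cP]]]] := ratio_coloring k0 a0 b0.
  have [x [Ax [f [xf cf]]]] := regA k k0k n n0 c ceq.
  exists (fun i => f i).
    by rewrite (_ : \col_i _ = x) //; apply/colP => i; rewrite mxE xf.
  by move=> i j; apply: contraNneq => /cP cij; exact/eqP/cf.
(* Only positivity of the entries is wanted here, and every rainbow vector has it. *)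
have [p Ap _] := has_rainbow 1%N 1%N isT isT.
split.
  by exists (\col_i (p i).+1%:R); split=> // i; rewrite mxE natr_int ltr0n.
move=> i j /eqP ij; have [f Af fP] := has_rainbow (p i).+1 (p j).+1 isT isT.
exists (\col_i (f i).+1%:R), (\col_i (p i).+1%:R); split=> //; rewrite !mxE.
by apply/eqP; rewrite -!natrM eqr_nat fP.
Qed.

Lemma robustly_rainbow_regular_sufficient (R : realType) m d (A : 'M[rat]_(m, d)) :
  has_positive_integer_ker_vector A -> pairwise_nonproportional_ker A ->
  robustly_rainbow_regular R A.
Proof.
move=> Apos Apair; have [p [q pq]] := exists_generic_pair Apos Apair.
pose B := (\sum_i (p i + q i)).+1%N.
have le_B i : (p i + q i <= B)%N by rewrite /B (bigD1 i) //= leqW // leq_addr.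
have pB i : (p i <= B)%N by apply: leq_trans (le_B i); exact: leq_addr.
have qB i : (q i <= B)%N by apply: leq_trans (le_B i); exact: leq_addl.
pose Q := (16 * B ^ 2 * d ^ 2)%N.
(* The threshold gives [Q <= sqrt k], so classes have at most N/Q elements, and [2 * B <= k <= N] by
   surjectivity of the coloring. *)
exists 1; split=> // eps eps0; exists (Q ^ 2 + 2 * B)%N => k kP N N0 c csurj cN.
have Qk : Q%:R <= Num.sqrt k%:R :> R.
  rewrite -[Q%:R]ger0_norm // -sqrtr_sqr ler_sqrt // -natrX ler_nat.
  by apply: leq_trans kP; exact: leq_addr.
have k0 : 0 < Num.sqrt k%:R :> R by rewrite sqrtr_gt0 ltr0n; lia.
have kN : (k <= N)%N.
  rewrite -[k]card_ord -[N]card_ord; apply: leq_trans (leq_image_card c _).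
  by apply/subset_leq_card/subsetP => j _; have [a <-] := csurj j; exact: image_f.
apply: (generic_pair_rainbow pq (B := B)) => // [|j]; first by lia.
rewrite -(ler_nat R) natrM -/Q; apply: (@le_trans _ _ (Q%:R * (N%:R / Num.sqrt k%:R))).
  apply: ler_wpM2l => //; apply: le_trans (cN j) _.
  apply: ler_piMl; first by rewrite divr_ge0 ?ler0n ?ltW.
  by rewrite gerBl ltW.
by rewrite mulrCA ler_piMr // ler_pdivrMr // mul1r.
Qed.

Lemma robustly_rainbow_regularW (R : realType) m d (A : 'M[rat]_(m, d)) :
  robustly_rainbow_regular R A -> rainbow_regular A.
Proof.
(* With eps = C/2 the allowed class size is (C/2) n sqrt k, which is at least n once sqrt k reaches
   2/C. *)
move=> [C [C0 CP]]; have [|k0 k0P] := CP (C / 2); first by rewrite divr_gt0.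
pose b := Num.bound (2 / C); exists (k0 + b ^ 2).+1%N => k kP n n0 c ceq.
apply: (k0P k _ _ _ c) => [|||j]; [lia | by rewrite muln_gt0 n0; lia | by case: ceq |].
have [_ ->] := ceq.
have k_gt0 : 0 < k%:R :> R by rewrite ltr0n; lia.
have sk0 : 0 < Num.sqrt k%:R :> R by rewrite sqrtr_gt0.
have sk : 2 / C <= Num.sqrt k%:R.
  apply: le_trans (ltW (archi_boundP _)) _; first by rewrite divr_ge0 // ltW.
  rewrite -[X in X <= _]ger0_norm // -sqrtr_sqr ler_sqrt // -natrX ler_nat.
  by move: kP; rewrite -/b; lia.
have -> : (C - C / 2) * ((k * n)%:R / Num.sqrt k%:R) = C / 2 * Num.sqrt k%:R * n%:R.
  rewrite natrM -{1}(sqr_sqrtr (ltW k_gt0)); field; exact: lt0r_neq0.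
apply: ler_peMl => //; rewrite -(ler_pM2l (_ : 0 < 2 / C)) ?divr_gt0 //.
rewrite mulr1 mulrA (_ : 2 / C * (C / 2) = 1) ?mul1r //.
by field; exact: lt0r_neq0.
Qed.

Theorem theorem1 (R : realType) (m d : nat) (A : 'M[rat]_(m, d)) :
  [<-> rainbow_regular A;
       robustly_rainbow_regular R A;
       has_positive_integer_ker_vector A /\ rank_stable_under_two_deletions A;
       has_positive_integer_ker_vector A /\ pairwise_nonproportional_ker A].
Proof.
have i_iv := @rainbow_regular_necessary m d A.
have iv_ii := @robustly_rainbow_regular_sufficient R m d A.
have ii_i := @robustly_rainbow_regularW R m d A.
have iii_iv := rank_stable_pairwise_nonproportional A.
by tfae; tauto.
Qed.
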